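(* Let $\mathfrak g$ be a three-dimensional non-unimodular real Lie algebra equipped with a positive definite inner product $g$. Then there exist $\varphi,\xi,\eta$ such that $(\varphi,\xi,\eta,g)$ is an almost contact metric structure on $\mathfrak g$ with $\xi\in\ker d\eta$.
   Context: An almost contact metric structure on a real Lie algebra $\mathfrak g$ of dimension $2n+1$ is a quadruple $(\varphi,\xi,\eta,g)$ where $\varphi\in\mathrm{End}(\mathfrak g)$, $\xi\in\mathfrak g$, $\eta\in\mathfrak g^*$ and $g$ is a positive definite inner product on $\mathfrak g$, such that $\eta(\xi)=1$, $\varphi(\xi)=0$, $\eta\circ\varphi=0$, $\varphi^2=-\mathrm{Id}+\eta\otimes\xi$, and $g(\varphi X,\varphi Y)=g(X,Y)-\eta(X)\eta(Y)$ for all $X,Y\in\mathfrak g$. Such structures correspond to left-invariant almost contact metric structures on Lie groups with Lie algebra $\mathfrak g$. The exterior derivative is that of left-invariant forms: $d\eta(X,Y)=-\eta([X,Y])$; the condition $\xi\in\ker d\eta$ means $d\eta(\xi,X)=0$ for all $X\in\mathfrak g$. A Lie algebra is unimodular if $\operatorname{trace}\,\mathrm{ad}(x)=0$ for all $x$, and non-unimodular otherwise. *)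

(* Defs.v *)
From HB Require Import structures.
From mathcomp Require Import all_boot all_order all_algebra.
From mathcomp Require Import reals.

Set Implicit Arguments.
Unset Strict Implicit.
Unset Printing Implicit Defensive.

Import Order.TTheory GRing.Theory Num.Theory.
Local Open Scope ring_scope.

HB.mixin Record Vector_isLieAlgebra (K : fieldType) V of Vector K V := {
  lie : V -> V -> V;
  lie_linearl : forall y, linear (lie^~ y);
  lie_linearr : forall x, linear (lie x);
  liexx : forall x, lie x x = 0;
  lie_jacobi : forall x y z,
    lie x (lie y z) + lie y (lie z x) + lie z (lie x y) = 0
}.

#[short(type="lieAlgType")]
HB.structure Definition LieAlgebra (K : fieldType) :=
  { V of Vector_isLieAlgebra K V & Vector K V }.

HB.instance Definition _ (K : fieldType) (L : lieAlgType K) (x : L) :=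
  GRing.isLinear.Build K L L _ (lie x) (lie_linearr x).

Section LieAlgebra.
Variables (K : fieldType) (L : lieAlgType K).

Definition ad (x : L) : 'End(L) := linfun (lie x).

Lemma adE x y : ad x y = lie x y.
Proof. exact: lfunE. Qed.

(* The trace does not depend on the basis used to represent [f]. *)
Definition lftrace (f : 'End(L)) : K :=
  \tr (passmx.mxof (vbasis {:L}) (vbasis {:L}) f).

Definition unimodular : Prop := forall x : L, lftrace (ad x) = 0.

(* Exterior derivative of a left-invariant 1-form. *)
Definition ext_d (eta : 'Hom(L, K^o)) (x y : L) : K := - eta (lie x y).

End LieAlgebra.

Arguments unimodular {K} L.

Record almost_contact_metric (R : realType) (L : lieAlgType R)
    (phi : 'End(L)) (xi : L) (eta : 'Hom(L, R^o)) (g : {dot L for idfun}) :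
    Prop := AlmostContactMetric {
  acm_dim : odd (\dim {:L});
  acm_eta_xi : eta xi = 1;
  acm_phi_xi : phi xi = 0;
  acm_eta_phi : forall x, eta (phi x) = 0;
  acm_phi2 : forall x, phi (phi x) = - x + eta x *: xi;
  acm_metric : forall x y, g (phi x) (phi y) = g x y - eta x * eta y
}.

(* Main.v *)
Require Import Defs.
From HB Require Import structures.
From mathcomp Require Import all_boot all_order all_algebra.
From mathcomp Require Import reals.
From mathcomp Require Import ring.

(** Let [t x] be the trace of [ad x].  Since [ad [x, y]] is the commutator of
    [ad x] and [ad y], the linear form [t] vanishes on all brackets; since the
    algebra is not unimodular, [t] is nonzero, so its kernel is a proper
    subspace.  A unit vector [xi] normal to that kernel does the job: the form
    [eta = g(-, xi)] vanishes on the kernel of [t], hence on all brackets, so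
    that [d eta = 0] altogether ([trace_ad_lie], [exists_unit_normal]).

    It remains to complete [(xi, eta, g)] to an almost contact metric
    structure, and here dimension three enters: the plane orthogonal to [xi]
    has an orthonormal basis [(e1, e2)], and the quarter turn [e1 -> e2 -> - e1]
    of that plane, extended by [0] on [xi], is a suitable [phi]
    ([almost_contact_metric_frame]). *)

Set Implicit Arguments.
Unset Strict Implicit.
Unset Printing Implicit Defensive.

Import Order.TTheory GRing.Theory Num.Theory.
Local Open Scope ring_scope.

Section TraceAd.
Variables (K : fieldType) (L : lieAlgType K).
Implicit Types (x y z : L) (f h : 'End(L)).

Lemma lftrace_is_linear : linear (@lftrace K L : 'End(L) -> K^o).
Proof. by move=> a f h; rewrite /lftrace passmx.mxof_linear mxtraceD mxtraceZ. Qed.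

Lemma lftrace_comp f h : lftrace (f \o h)%VF = lftrace (h \o f)%VF.
Proof.
have basisL := vbasisP {:L}.
by rewrite /lftrace !(passmx.mxof_comp _ _ basisL) mxtrace_mulC.
Qed.

Lemma lie_anticomm x y : lie x y = - lie y x.
Proof.
have := liexx (x + y); rewrite linearD /=.
have lieDl z : lie (x + y) z = lie x z + lie y z.
  by have := lie_linearl z 1 x y; rewrite !scale1r.
by rewrite !lieDl !liexx add0r addr0 => /eqP; rewrite addrC addr_eq0 => /eqP.
Qed.

(** The Jacobi identity, read as: [ad] is a morphism to the commutator
    bracket. *)
Lemma ad_lie x y : ad (lie x y) = (ad x \o ad y)%VF - (ad y \o ad x)%VF.
Proof.
apply/lfunP => z; rewrite !lfunE /= !lfunE /= !lfunE /= !adE.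
have /eqP := lie_jacobi x y z; rewrite addr_eq0 => /eqP xyz.
by rewrite lie_anticomm -xyz [lie z x]lie_anticomm linearN.
Qed.

Definition trace_ad x : K^o := lftrace (ad x).

Lemma trace_ad_is_linear : linear trace_ad.
Proof.
move=> a x y.
have adP : ad (a *: x + y) = a *: ad x + ad y.
  by apply/lfunP => z; rewrite !lfunE /= !lfunE /= adE lie_linearl.
by rewrite /trace_ad adP lftrace_is_linear.
Qed.

HB.instance Definition _ :=
  GRing.isLinear.Build K L K^o _ trace_ad trace_ad_is_linear.

Lemma trace_ad_lie x y : trace_ad (lie x y) = 0.
Proof.
have lftraceB f h : lftrace (f - h) = lftrace f - lftrace h.
  by rewrite addrC -scaleN1r lftrace_is_linear scaleN1r addrC.
by rewrite /trace_ad ad_lie lftraceB lftrace_comp subrr.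
Qed.

Lemma dim_ker_trace_ad :
  ~ unimodular L -> (\dim (lker (linfun trace_ad)) < \dim {:L})%N.
Proof.
move=> nuL; rewrite ltn_neqAle dimvS ?subvf // andbT.
apply/negP => /eqP dimE; apply: nuL => x.
have /eqP kerE : lker (linfun trace_ad) == fullv.
  by rewrite eqEdim subvf dimE leqnn.
have : x \in lker (linfun trace_ad) by rewrite kerE memvf.
by rewrite memv_ker lfunE => /eqP.
Qed.

End TraceAd.

Section InnerProduct.
Variables (R : rcfType) (V : vectType R) (g : {dot V for idfun}).
Implicit Types (x y : V) (U : {vspace V}).

Lemma dot_sym x y : g x y = g y x.
Proof. by rewrite hermitian_subproof expr0 mul1r. Qed.

(** A vector is orthogonal to [U] as soon as it satisfies [\dim U] linear
    equations, too few to force it to be zero. *)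
Lemma exists_unit_normal U : (\dim U < \dim {:V})%N ->
  exists2 e, g e e = 1 & {in U, forall u, g e u = 0}.
Proof.
move=> ltUV.
pose f x : 'rV[R]_(\dim U) := \row_i g x (vbasis U)`_i.
have f_linear : linear f.
  by move=> a x y; apply/rowP => i; rewrite !mxE linearPl.
pose fL : {linear V -> 'rV[R]_(\dim U)} :=
  HB.pack f (GRing.isLinear.Build _ _ _ _ f f_linear).
have ker_neq0 : lker (linfun fL) != 0%VS.
  rewrite -dimv_eq0; apply: contraTneq ltUV => ker0.
  rewrite -leqNgt -(limg_ker_dim (linfun fL) {:V}) capfv ker0 add0n.
  by rewrite (leq_trans (dimvS (subvf _))) // dimvf /dim /= mul1n.
pose v := vpick (lker (linfun fL)).
have v_neq0 : v != 0 by rewrite vpick0.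
have v_normal : {in U, forall u, g v u = 0}.
  have : v \in lker (linfun fL) by exact: memv_pick.
  rewrite memv_ker lfunE => /eqP/rowP fv0 u /coord_vbasis ->.
  rewrite linear_sumr big1 // => i _.
  by have := fv0 i; rewrite !mxE linearZr_LR /= => ->; rewrite mulr0.
have gvv_gt0 : 0 < g v v by exact: neq0_dnorm_gt0.
exists ((Num.sqrt (g v v))^-1 *: v); last first.
  by move=> u Uu; rewrite linearZl_LR /= (v_normal u Uu) mulr0.
rewrite linearZl_LR linearZr_LR /= mulrA -expr2 exprVn sqr_sqrtr ?ltW //.
by rewrite mulVf ?gt_eqF.
Qed.

Section OrthonormalBasis.
Variables (n : nat) (e : n.-tuple V).
Hypotheses (dimV : \dim {:V} = n)
  (eP : forall i j : 'I_n, g e`_i e`_j = (i == j)%:R).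

Let dot_comb (k : 'I_n -> R) (i : 'I_n) : g (\sum_j k j *: e`_j) e`_i = k i.
Proof.
rewrite linear_sumlz (bigD1 i) //= big1 => [|j /negPf j_neq_i].
  by rewrite linearZl_LR /= eP eqxx mulr1 addr0.
by rewrite linearZl_LR /= eP j_neq_i mulr0.
Qed.

Lemma orthonormal_basis : basis_of fullv e.
Proof.
rewrite basisEfree subvf size_tuple dimV leqnn /= andbT.
apply/freeP => k k0 i.
by rewrite -[LHS]dot_comb k0 linear0l.
Qed.

Lemma orthonormal_expansion x : x = \sum_(i < n) g x e`_i *: e`_i.
Proof.
rewrite [LHS](coord_basis orthonormal_basis (memvf x)).
apply: eq_bigr => i _.
by rewrite [in RHS](coord_basis orthonormal_basis (memvf x)) dot_comb.
Qed.

End OrthonormalBasis.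

Definition quarter_turn e1 e2 x : V := g x e1 *: e2 - g x e2 *: e1.

Lemma quarter_turn_is_linear e1 e2 : linear (quarter_turn e1 e2).
Proof.
move=> a x y; rewrite /quarter_turn !linearPl /= !scalerDl scalerBr !scalerA.
by rewrite opprD addrACA.
Qed.

HB.instance Definition _ e1 e2 :=
  GRing.isLinear.Build R V V _ (quarter_turn e1 e2)
    (quarter_turn_is_linear e1 e2).

End InnerProduct.

(** In the frame [(xi, e1, e2)] the axioms are those of the rotation by a right
    angle of an oriented Euclidean plane: it squares to [- id] and is an
    isometry. *)
Lemma almost_contact_metric_frame (R : realType) (L : lieAlgType R)
    (g : {dot L for idfun}) (xi e1 e2 : L) :
  \dim {:L} = 3%N -> g xi xi = 1 -> g e1 e1 = 1 -> g e2 e2 = 1 ->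
  g e1 xi = 0 -> g e2 xi = 0 -> g e2 e1 = 0 ->
  almost_contact_metric (linfun (quarter_turn g e1 e2)) xi
    (linfun (applyr g xi : L -> R^o)) g.
Proof.
move=> dimL g00 g11 g22 g10 g20 g21.
have [g01 g02 g12] : [/\ g xi e1 = 0, g xi e2 = 0 & g e1 e2 = 0].
  by split; rewrite dot_sym.
have expand x : x = g x xi *: xi + g x e1 *: e1 + g x e2 *: e2.
  have eP (i j : 'I_3) :
      g [tuple xi; e1; e2]`_i [tuple xi; e1; e2]`_j = (i == j)%:R.
    by case: i j => [[|[|[|//]]] ?] [[|[|[|//]]] ?].
  rewrite [LHS](orthonormal_expansion dimL eP).
  by rewrite !big_ord_recl big_ord0 /= addr0 addrA.
have parseval x y : g x y = g x xi * g y xi + g x e1 * g y e1 + g x e2 * g y e2.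
  rewrite [in LHS](expand x) !linearDl !linearZl_LR /=.
  by rewrite (dot_sym g xi) (dot_sym g e1) (dot_sym g e2).
have turn0 x : g (quarter_turn g e1 e2 x) xi = 0.
  by rewrite linearBl !linearZl_LR /= g10 g20 !mulr0 subrr.
have turn1 x : g (quarter_turn g e1 e2 x) e1 = - g x e2.
  by rewrite linearBl !linearZl_LR /= g11 g21 mulr0 mulr1 sub0r.
have turn2 x : g (quarter_turn g e1 e2 x) e2 = g x e1.
  by rewrite linearBl !linearZl_LR /= g12 g22 mulr0 mulr1 subr0.
split.
- by rewrite dimL.
- by rewrite lfunE.
- by rewrite lfunE /= /quarter_turn g01 g02 !scale0r subrr.
- by move=> x; rewrite !lfunE /= turn0.
- move=> x; rewrite !lfunE /= [LHS]/quarter_turn turn1 turn2.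
  rewrite [in - x](expand x) !opprD scaleNr [LHS]addrC [RHS]addrC.
  by rewrite !addrA subrr add0r.
- move=> x y; rewrite !lfunE /= (parseval (quarter_turn _ _ _ _)).
  by rewrite !turn0 !turn1 !turn2 (parseval x y); ring.
Qed.

Theorem corollary2p7 (R : realType) (L : lieAlgType R)
  (dimL : \dim {:L} = 3%N) (nuL : ~ unimodular L) (g : {dot L for idfun}) :
  exists (phi : 'End(L)) (xi : L) (eta : 'Hom(L, R^o)),
    almost_contact_metric phi xi eta g /\
    (forall x : L, ext_d eta xi x = 0).
Proof.
have [xi g00 xi_normal] := exists_unit_normal g (dim_ker_trace_ad nuL).
have [|e1 g11 e1_normal] := exists_unit_normal g (U := <[xi]>).
  by rewrite dimL dim_vline; case: (_ != _).
have [|e2 g22 e2_normal] := exists_unit_normal g (U := (<[xi]> + <[e1]>)%VS).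
  rewrite dimL (leq_ltn_trans (dimv_add_leqif _ _)) // !dim_vline.
  by do 2!case: (_ != _).
exists (linfun (quarter_turn g e1 e2)), xi, (linfun (applyr g xi : L -> R^o)).
split.
  apply: almost_contact_metric_frame => //.
  - by rewrite e1_normal ?memv_line.
  - by rewrite e2_normal // (subvP (addvSl _ _)) ?memv_line.
  - by rewrite e2_normal // (subvP (addvSr _ _)) ?memv_line.
move=> x; rewrite /ext_d lfunE /= dot_sym xi_normal ?oppr0 //.
by rewrite memv_ker lfunE /= trace_ad_lie.
Qed.
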